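(* There is a computable coloring $c:\mathbb{N}\to\{0,1,2\}$ such that for every infinite set $X\subseteq\mathbb{N}$ for which $\mathrm{FS}^{\leq 3}(X)$ is monochromatic for $c$, we have $0'\leq_T X$.
   Context: $\mathbb{N}$ denotes the set of positive integers. For a finite nonempty $F\subseteq\mathbb{N}$, $\sum F$ denotes the sum of the elements of $F$. For $X\subseteq\mathbb{N}$ and $n\geq 1$, $\mathrm{FS}^{\leq n}(X)=\{\sum F \mid F\subseteq X \text{ and } 1\leq |F|\leq n\}$. A set $Z\subseteq\mathbb{N}$ is monochromatic for a coloring $c$ if $c(x)=c(y)$ for all $x,y\in Z$. $0'$ is the halting problem and $\leq_T$ is Turing reducibility. *)

(* Defs.v *)
From mathcomp Require Import all_boot finmap.
From mathcomp Require Import boolp classical_sets functions cardinality.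
From mathcomp Require Import zify.
From Stdlib Require Cantor.

Set Implicit Arguments.
Unset Strict Implicit.
Unset Printing Implicit Defensive.

Local Open Scope classical_set_scope.
Local Open Scope nat_scope.

(* Partial recursive functions with an oracle, as unary functions on nat;      *)
(* several arguments are passed through the Cantor pairing                     *)
(* <x, y> := Cantor.to_nat (x, y), a bijection nat * nat -> nat.               *)
Inductive code : Type :=
  | Zero | Succ | Fst | Snd
  | Oracle
  | Pair of code & code
  | Comp of code & code
  | PRec of code & code
  | Mu of code.

(* eval O p n y : the program p with oracle O halts on input n with output y.  *)
(* - PRec f g computes h with h <a, 0> = f a and                               *)
(*   h <a, k.+1> = g <a, <k, h <a, k>>>.                                       *)
(* - Mu f on input n returns the least y such that f <n, y> = 0, provided that *)
(*   f <n, k> is defined for all k < y.                                        *)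
Fixpoint eval (O : set nat) (p : code) (n y : nat) : Prop :=
  match p with
  | Zero => y = 0
  | Succ => y = n.+1
  | Fst => y = (Cantor.of_nat n).1
  | Snd => y = (Cantor.of_nat n).2
  | Oracle => y = `[< O n >]
  | Pair f g => exists a b,
      [/\ eval O f n a, eval O g n b & y = Cantor.to_nat (a, b)]
  | Comp f g => exists2 a, eval O g n a & eval O f a y
  | PRec f g =>
      let: (a, m) := Cantor.of_nat n in
      (fix rec (m z : nat) : Prop :=
         if m is k.+1 then
           exists2 i, rec k i &
             eval O g (Cantor.to_nat (a, Cantor.to_nat (k, i))) z
         else eval O f a z) m y
  | Mu f => eval O f (Cantor.to_nat (n, y)) 0 /\
      forall k, k < y -> exists v, eval O f (Cantor.to_nat (n, k)) v.+1
  end.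

Lemma eval_functional O p n y z : eval O p n y -> eval O p n z -> y = z.
Proof.
elim: p n y z => [||||| f IHf g IHg | f IHf g IHg | f IHf g IHg | f IHf] n y z /=;
  try by move=> -> ->.
- move=> [a [b [fa gb ->]]] [a' [b' [fa' gb' ->]]].
  by rewrite (IHf _ _ _ fa fa') (IHg _ _ _ gb gb').
- by move=> [a ga fy] [b gb fz]; rewrite -(IHg _ _ _ ga gb) in fz; apply: IHf fy fz.
- case: (Cantor.of_nat n) => a m.
  elim: m y z => [|m IHm] y z; first exact: IHf.
  by move=> [i ri gy] [j rj gz]; rewrite -(IHm _ _ ri rj) in gz; apply: IHg gy gz.
- move=> [fy ly] [fz lz]; case: (ltngtP y z) => // [/lz|/ly] [v fv].
  + by have := IHf _ _ _ fy fv.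
  + by have := IHf _ _ _ fz fv.
Qed.

(* Goedel numbering of the programs; it is a bijection code -> nat.            *)
Fixpoint encode (p : code) : nat :=
  match p with
  | Zero => 0
  | Succ => 1
  | Fst => 2
  | Snd => 3
  | Oracle => 4
  | Pair f g => 5 + 4 * Cantor.to_nat (encode f, encode g)
  | Comp f g => 6 + 4 * Cantor.to_nat (encode f, encode g)
  | PRec f g => 7 + 4 * Cantor.to_nat (encode f, encode g)
  | Mu f => 8 + 4 * encode f
  end.

Lemma encode_inj : injective encode.
Proof.
move=> p; elim: p => [||||| f IHf g IHg | f IHf g IHg | f IHf g IHg | f IHf]
  [||||| f' g' | f' g' | f' g' | f'] //; cbn [encode] => e; try by exfalso; lia.
1-3: have /Cantor.to_nat_inj [/IHf -> /IHg ->] :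
       Cantor.to_nat (encode f, encode g) = Cantor.to_nat (encode f', encode g')
       by lia.
1-3: by [].
by rewrite (IHf f') //; lia.
Qed.

Lemma encode_surj e : exists p, encode p = e.
Proof.
have [m] := ubnP e; elim: m e => // m IHm e lt_em.
case: e lt_em => [|[|[|[|[|e]]]]] lt_em.
- by exists Zero.
- by exists Succ.
- by exists Fst.
- by exists Snd.
- by exists Oracle.
have e_eq : e = e %/ 4 * 4 + e %% 4 by exact: divn_eq.
have := ltn_pmod e (isT : 0 < 4).
case E : (Cantor.of_nat (e %/ 4)) => [a b].
have ab : Cantor.to_nat (a, b) = e %/ 4 by rewrite -E Cantor.cancel_to_of.
have := Cantor.to_nat_non_decreasing a b; rewrite ab => le_ab.
have [f ef] : exists p, encode p = a by apply: IHm; lia.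
have [g eg] : exists p, encode p = b by apply: IHm; lia.
have [h eh] : exists p, encode p = e %/ 4 by apply: IHm; lia.
move: e_eq; case: (e %% 4) => [|[|[|[|//]]]] e_eq _.
- by exists (Pair f g); cbn [encode]; rewrite ef eg ab; lia.
- by exists (Comp f g); cbn [encode]; rewrite ef eg ab; lia.
- by exists (PRec f g); cbn [encode]; rewrite ef eg ab; lia.
- by exists (Mu h); cbn [encode]; rewrite eh; lia.
Qed.

Definition computable_in (O : set nat) (f : nat -> nat) : Prop :=
  exists p, forall n, eval O p n (f n).

(* The empty oracle is itself computable and so provides no information.       *)
Definition computable (f : nat -> nat) : Prop := computable_in set0 f.

Definition turing_le (A B : set nat) : Prop :=
  computable_in B (fun n => `[< A n >] : nat).

Definition jump (O : set nat) : set nat :=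
  [set e | exists p, encode p = e /\ exists y, eval O p e y].

Definition halting_problem : set nat := jump set0.

Definition positives : set nat := [set n | 0 < n].

Definition FS_le (n : nat) (X : set nat) : set nat :=
  [set s | exists F : {fset nat},
    [/\ [set` F] `<=` X, 1 <= #|` F | <= n & s = \sum_(x <- F) x]].

Definition monochromatic (T : Type) (c : nat -> T) (Z : set nat) : Prop :=
  forall x y, Z x -> Z y -> c x = c y.

(* Main.v *)
(* Write numbers in base 7 and call the pair (n, k) of positions of two         *)
(* consecutive nonzero digits of w a gap of w. The gap is short if some e <= n  *)
(* enters 0' after stage k, and very short in w if some e <= n does so between  *)
(* stage k and the top position of w. The parity of the number of very short    *)
(* gaps is computable. If x < 7^lam y, where 7^lam y is the largest power of 7  *)
(* dividing y, the digits of x + y are those of x followed by those of y; when  *)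
(* y starts late, the very short gaps of x + y are the short gaps of x and the  *)
(* very short gaps of y. Hence if the parity is constant on sums of at most     *)
(* three spread-out elements, then x, y and x + y all have an even number of    *)
(* short gaps, so the gap between x and y is not short, and lam y bounds the    *)
(* stages at which elements below the top position of x enter 0'.               *)
(*                                                                              *)
(* To force X to contain spread-out elements with only three colors, the color  *)
(* is the parity plus the class d(i) mod 3, where i is the lowest nonzero digit *)
(* and d(i) depends on i^2 mod 7 in {1, 2, 4}. Then i, 2i and 3i lie in three   *)
(* different classes, and a parity only shifts a class by 0 or 1; so x, x + y   *)
(* and x + y + z cannot have the same color when x, y, z have the same lowest   *)
(* nonzero digit at the same position.                                          *)
Require Import Defs.
From mathcomp Require Import all_boot finmap boolp classical_sets cardinality.
From mathcomp Require Import zify.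
From Stdlib Require Cantor.

Set Implicit Arguments.
Unset Strict Implicit.
Unset Printing Implicit Defensive.

Local Open Scope classical_set_scope.
Local Open Scope nat_scope.

(** * Closure properties of the computable functions *)

(** [halts_by] is a decidable enumeration of [0'] ([halts_byP]), and a solution [X] has to reveal
    how long to wait in it. When the expansion of [x] ends below the lowest digit of [y], the gaps
    of [x + y] are those of [x], those of [y] and one new gap ([gapsD]). The color sees only very
    short gaps, but if [z] starts late, those of [s + z] below [z] are exactly the short gaps of
    [s]; so equal colors of [z] and [s + z] force [s] to have evenly many short gaps ([even_gaps]).
    With [s] equal to [x], [y] and [x + y], the gap between [x] and [y] cannot be short
    ([halts_by_gap]): every [e <= mu x] in [0'] has entered by stage [lam y]. Such pairs are found
    by searching with oracle [X].

    This needs elements of [X] that start arbitrarily late with one fixed lowest digit.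
    [no_three_same_lead] leaves finitely many elements for each position and digit, and
    [exists_lead] is the pigeonhole principle. *)

Definition cpair (x y : nat) : nat := Cantor.to_nat (x, y).
Definition cfst (n : nat) : nat := (Cantor.of_nat n).1.
Definition csnd (n : nat) : nat := (Cantor.of_nat n).2.

Lemma cfst_pair x y : cfst (cpair x y) = x.
Proof. by rewrite /cfst /cpair Cantor.cancel_of_to. Qed.

Lemma csnd_pair x y : csnd (cpair x y) = y.
Proof. by rewrite /csnd /cpair Cantor.cancel_of_to. Qed.

Lemma cpair_cfst_csnd n : cpair (cfst n) (csnd n) = n.
Proof. by rewrite /cpair /cfst /csnd -surjective_pairing Cantor.cancel_to_of. Qed.

Lemma leq_cpair x y : x + y <= cpair x y.
Proof. by have := Cantor.to_nat_non_decreasing x y; rewrite /cpair; lia. Qed.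

Section Closure.
Variable O : set nat.
Local Notation C := (computable_in O).

Lemma computable_ext f g : f =1 g -> C f -> C g.
Proof. by move=> fg [p pf]; exists p => n; rewrite -fg. Qed.

Lemma computable_comp f g : C f -> C g -> C (fun n => f (g n)).
Proof. by move=> [p pf] [q qg]; exists (Comp p q) => n; exists (g n). Qed.

Lemma computable_cpair f g : C f -> C g -> C (fun n => cpair (f n) (g n)).
Proof. by move=> [p pf] [q qg]; exists (Pair p q) => n; exists (f n), (g n). Qed.

Lemma computable_cfst f : C f -> C (fun n => cfst (f n)).
Proof. by apply: computable_comp; exists Fst. Qed.

Lemma computable_csnd f : C f -> C (fun n => csnd (f n)).
Proof. by apply: computable_comp; exists Snd. Qed.

Lemma computable_S f : C f -> C (fun n => (f n).+1).
Proof. by apply: computable_comp; exists Succ. Qed.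

Lemma computable_oracle f : C f -> C (fun n => `[< O (f n) >]).
Proof. by apply: (@computable_comp (fun n => `[< O n >])); exists Oracle. Qed.

Lemma computable_id : C id.
Proof.
apply: (@computable_ext (fun n => cpair (cfst n) (csnd n))).
  by move=> n; rewrite cpair_cfst_csnd.
by apply: computable_cpair; [exists Fst | exists Snd].
Qed.

Lemma computable_const c : C (fun=> c).
Proof. by elim: c => [|c IHc]; [exists Zero | apply: computable_S]. Qed.

Lemma computable_iteri G m a :
    C (fun q => G (cfst q) (cfst (csnd q)) (csnd (csnd q))) -> C m -> C a ->
  C (fun n => iteri (m n) (G n) (a n)).
Proof.
move=> [pG GP] mP [pa aP].
have [p pP] := computable_cpair computable_id mP.
exists (Comp (PRec pa pG) p) => n /=; exists (cpair n (m n)); first exact: pP.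
rewrite /cpair Cantor.cancel_of_to; elim: (m n) => [|k IHk] /=; first exact: aP.
exists (iteri k (G n) (a n)) => //.
by have := GP (cpair n (cpair k (iteri k (G n) (a n))));
   rewrite !(cfst_pair, csnd_pair).
Qed.

Lemma computable_search (R : nat -> nat -> bool) :
    C (fun q => R (cfst q) (csnd q)) -> (forall n, exists y, R n y) ->
  exists2 f, C f & forall n, R n (f n).
Proof.
move=> [pR RP] exR; exists (fun n => ex_minn (exR n)); last first.
  by move=> n; case: ex_minnP.
(* [Mu] stops at the value 0, so the search runs on [1 - R], which is 0 exactly where [R] is
   true. *)
have [pN NP] : C (fun n => 1 - n).
  apply: (@computable_ext (fun n => iteri n (fun _ _ => 0) 1)).
    by case=> //= n; lia.
  apply: (@computable_iteri (fun _ _ _ => 0)) computable_id _;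
    exact: computable_const.
have evalN n y : eval O (Comp pN pR) (Cantor.to_nat (n, y)) (1 - R n y).
  have := RP (cpair n y); rewrite cfst_pair csnd_pair => Rny /=.
  by exists (R n y : nat) => //; apply: NP.
exists (Mu (Comp pN pR)) => n; case: ex_minnP => y Rny min_y.
split=> [|k lt_ky]; first by have := evalN n y; rewrite Rny.
exists 0; have := evalN n k.
by case Rnk : (R n k) => //; have := min_y k Rnk; lia.
Qed.

Lemma computable_add f g : C f -> C g -> C (fun n => f n + g n).
Proof.
move=> Cf Cg; apply: (@computable_ext (fun n => iteri (g n) (fun _ r => r.+1) (f n))).
  by move=> n; elim: (g n) => [|k /= ->]; rewrite ?addn0 ?addnS.
apply: (@computable_iteri (fun _ _ r => r.+1)) => //.
by apply/computable_S/computable_csnd/computable_csnd/computable_id.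
Qed.

Lemma computable_pred f : C f -> C (fun n => (f n).-1).
Proof.
move=> Cf; apply: (@computable_ext (fun n => iteri (f n) (fun k _ => k) 0)).
  by move=> n; case: (f n).
apply: (@computable_iteri (fun _ k _ => k)) => //; last exact: computable_const.
by apply/computable_cfst/computable_csnd/computable_id.
Qed.

Lemma computable_sub f g : C f -> C g -> C (fun n => f n - g n).
Proof.
move=> Cf Cg; apply: (@computable_ext (fun n => iteri (g n) (fun _ r => r.-1) (f n))).
  by move=> n; elim: (g n) => [|k /= ->]; rewrite ?subn0 ?subnS.
apply: (@computable_iteri (fun _ _ r => r.-1)) => //.
by apply/computable_pred/computable_csnd/computable_csnd/computable_id.
Qed.

Lemma computable_sum F b :
    C (fun q => F (cfst q) (csnd q)) -> C b ->
  C (fun n => \sum_(i < b n) F n i).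
Proof.
move=> CF Cb.
apply: (@computable_ext (fun n => iteri (b n) (fun k r => r + F n k) 0)).
  move=> n; elim: (b n) => [|k IHk]; first by rewrite big_ord0.
  by rewrite big_ord_recr /= -IHk.
apply: (@computable_iteri (fun n k r => r + F n k)) => //; last exact: computable_const.
apply: computable_add.
  by apply/computable_csnd/computable_csnd/computable_id.
apply: (@computable_ext (fun q => F (cfst (cpair (cfst q) (cfst (csnd q))))
                                    (csnd (cpair (cfst q) (cfst (csnd q)))))).
  by move=> q; rewrite cfst_pair csnd_pair.
apply: (computable_comp CF); apply: computable_cpair.
  by apply/computable_cfst/computable_id.
by apply/computable_cfst/computable_csnd/computable_id.
Qed.

Lemma computable_mul f g : C f -> C g -> C (fun n => f n * g n).
Proof.
move=> Cf Cg; apply: (@computable_ext (fun n => \sum_(i < g n) f n)).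
  by move=> n; rewrite sum_nat_const card_ord mulnC.
apply: (@computable_sum (fun n _ => f n)) => //.
by apply: (computable_comp Cf); apply/computable_cfst/computable_id.
Qed.

Lemma computable_exp f g : C f -> C g -> C (fun n => f n ^ g n).
Proof.
move=> Cf Cg; apply: (@computable_ext (fun n => iteri (g n) (fun _ r => f n * r) 1)).
  by move=> n; elim: (g n) => [|k /= ->]; rewrite ?expnS.
apply: (@computable_iteri (fun n _ r => f n * r)) => //; last exact: computable_const.
apply: computable_mul; last by apply/computable_csnd/computable_csnd/computable_id.
by apply: (computable_comp Cf); apply/computable_cfst/computable_id.
Qed.

Lemma computable_leq f g : C f -> C g -> C (fun n => f n <= g n).
Proof.
move=> Cf Cg; apply: (@computable_ext (fun n => 1 - (f n - g n))).
  by move=> n; case: leqP; lia.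
by do 2?apply: computable_sub => //; apply: computable_const.
Qed.

Lemma computable_neg (b : nat -> bool) : C b -> C (fun n => ~~ b n).
Proof.
move=> Cb; apply: (@computable_ext (fun n => 1 - b n)); first by move=> n; case: (b n).
by apply: computable_sub => //; apply: computable_const.
Qed.

Lemma computable_and (a b : nat -> bool) : C a -> C b -> C (fun n => a n && b n).
Proof.
move=> Ca Cb; apply: (@computable_ext (fun n => a n * b n)); last exact: computable_mul.
by move=> n; rewrite mulnb.
Qed.

Lemma computable_implb (a b : nat -> bool) : C a -> C b -> C (fun n => a n ==> b n).
Proof.
move=> Ca Cb; apply: (@computable_ext (fun n => ~~ (a n && ~~ b n))).
  by move=> n; case: (a n) (b n) => [] [].
by apply/computable_neg/computable_and => //; apply: computable_neg.
Qed.

Lemma computable_eq f g : C f -> C g -> C (fun n => f n == g n).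
Proof.
move=> Cf Cg; apply: (@computable_ext (fun n => (f n <= g n) && (g n <= f n))).
  by move=> n; rewrite eqn_leq.
by apply: computable_and; apply: computable_leq.
Qed.

Lemma computable_if (b : nat -> bool) f g :
  C b -> C f -> C g -> C (fun n => if b n then f n else g n).
Proof.
move=> Cb Cf Cg; apply: (@computable_ext (fun n => b n * f n + ~~ b n * g n)).
  by move=> n; case: (b n); lia.
by apply: computable_add; apply: computable_mul => //; apply: computable_neg.
Qed.

Lemma computable_ifb (b f g : nat -> bool) :
  C b -> C f -> C g -> C (fun n => if b n then f n else g n).
Proof.
move=> Cb Cf Cg; apply: (computable_ext _ (computable_if Cb Cf Cg)) => n.
by case: (b n).
Qed.

Lemma computable_has (P : nat -> nat -> bool) b :
    C (fun q => P (cfst q) (csnd q)) -> C b ->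
  C (fun n => has (P n) (iota 0 (b n))).
Proof.
move=> CP Cb; apply: (@computable_ext (fun n => 0 < \sum_(i < b n) P n i)).
  move=> n; congr nat_of_bool; rewrite lt0n sum_nat_eq0; apply/idP/idP.
    move=> /forallPn[i]; rewrite /= eqb0 negbK => Pi; apply/hasP; exists (val i) => //.
    by rewrite mem_iota /=.
  move=> /hasP[i]; rewrite mem_iota /= => ltib Pi; apply/forallPn.
  by exists (Ordinal ltib); rewrite /= Pi.
apply: computable_leq; first exact: computable_const.
exact: (@computable_sum P).
Qed.

Lemma computable_all (P : nat -> nat -> bool) b :
    C (fun q => P (cfst q) (csnd q)) -> C b ->
  C (fun n => all (P n) (iota 0 (b n))).
Proof.
move=> CP Cb.
apply: (@computable_ext (fun n => ~~ has (fun i => ~~ P n i) (iota 0 (b n)))).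
  by move=> n; rewrite -all_predC; congr (nat_of_bool (all _ _));
     apply/funext => i /=; rewrite negbK.
by apply/computable_neg/(@computable_has (fun n i => ~~ P n i)) => //;
   apply: computable_neg.
Qed.

Lemma computable_divn f g : C f -> C g -> C (fun n => f n %/ g n).
Proof.
move=> Cf Cg.
(* The quotient counts the positive multiples of [g n] up to [f n]; the guard gives the value 0 of
   division by 0. *)
apply: (@computable_ext (fun n => \sum_(i < f n) ((0 < g n) && (i.+1 * g n <= f n)))).
  move=> n; case: (posnP (g n)) => [-> | g_gt0].
    by rewrite divn0 big1.
  rewrite -[RHS](@card_ord (f n %/ g n)) -sum1_card.
  rewrite (big_ord_widen _ (fun=> 1) (leq_div (f n) (g n))) [RHS]big_mkcond /=.
  by apply: eq_bigr => i _; rewrite -leq_divRL //; case: ltnP.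
apply: (@computable_sum (fun n i => (0 < g n) && (i.+1 * g n <= f n))) => //.
have Cfst h : C h -> C (fun q => h (cfst q)).
  by move=> /computable_comp; apply; apply/computable_cfst/computable_id.
apply: computable_and; first by apply: computable_leq; [exact: computable_const|exact: Cfst].
apply: computable_leq; last exact: Cfst.
apply: computable_mul; last exact: Cfst.
by apply/computable_S/computable_csnd/computable_id.
Qed.

Lemma computable_modn f g : C f -> C g -> C (fun n => f n %% g n).
Proof.
move=> Cf Cg; apply: (@computable_ext (fun n => f n - f n %/ g n * g n)).
  by move=> n; rewrite {1}(divn_eq (f n) (g n)) addKn.
by apply: computable_sub => //; apply: computable_mul => //; apply: computable_divn.
Qed.

Lemma computable_odd f : C f -> C (fun n => odd (f n)).
Proof.
move=> Cf; apply: (@computable_ext (fun n => f n %% 2)); first by move=> n; rewrite modn2.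
by apply: computable_modn => //; apply: computable_const.
Qed.

End Closure.

Ltac computability :=
  cbv beta;
  lazymatch goal with
  | |- computable_in ?O (fun n => n) => exact: computable_id
  | |- computable_in ?O cfst => exact: computable_cfst (computable_id O)
  | |- computable_in ?O csnd => exact: computable_csnd (computable_id O)
  | |- computable_in ?O (fun _ => ?c) => exact: computable_const
  | |- computable_in ?O (fun n => nat_of_bool (`[< ?O (@?f n) >])) =>
    apply: (@computable_oracle O f); computability
  | |- computable_in ?O (fun n => S (@?f n)) =>
    apply: (@computable_S O f); computability
  | |- computable_in ?O (fun n => (@?f n).-1) =>
    apply: (@computable_pred O f); computability
  | |- computable_in ?O (fun n => cfst (@?f n)) =>
    apply: (@computable_cfst O f); computability
  | |- computable_in ?O (fun n => csnd (@?f n)) =>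
    apply: (@computable_csnd O f); computability
  | |- computable_in ?O (fun n => cpair (@?f n) (@?g n)) =>
    apply: (@computable_cpair O f g); computability
  | |- computable_in ?O (fun n => @?f n + @?g n) =>
    apply: (@computable_add O f g); computability
  | |- computable_in ?O (fun n => @?f n - @?g n) =>
    apply: (@computable_sub O f g); computability
  | |- computable_in ?O (fun n => @?f n * @?g n) =>
    apply: (@computable_mul O f g); computability
  | |- computable_in ?O (fun n => @?f n ^ @?g n) =>
    apply: (@computable_exp O f g); computability
  | |- computable_in ?O (fun n => @?f n %/ @?g n) =>
    apply: (@computable_divn O f g); computability
  | |- computable_in ?O (fun n => @?f n %% @?g n) =>
    apply: (@computable_modn O f g); computability
  | |- computable_in ?O (fun n => nat_of_bool (odd (@?f n))) =>
    apply: (@computable_odd O f); computability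
  | |- computable_in ?O (fun n => nat_of_bool (@?f n <= @?g n)) =>
    apply: (@computable_leq O f g); computability
  | |- computable_in ?O (fun n => nat_of_bool (@?f n == @?g n)) =>
    apply: (@computable_eq O f g); computability
  | |- computable_in ?O (fun n => nat_of_bool (~~ (@?a n))) =>
    apply: (@computable_neg O a); computability
  | |- computable_in ?O (fun n => nat_of_bool (@?a n && @?b n)) =>
    apply: (@computable_and O a b); computability
  | |- computable_in ?O (fun n => nat_of_bool (@?a n ==> @?b n)) =>
    apply: (@computable_implb O a b); computability
  | |- computable_in ?O (fun n => nat_of_bool (has (@?P n) (iota 0 (@?b n)))) =>
    apply: (@computable_has O P b); computability
  | |- computable_in ?O (fun n => nat_of_bool (all (@?P n) (iota 0 (@?b n)))) =>
    apply: (@computable_all O P b); computability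
  | |- _ =>
    first [ simple apply computable_if; computability
          | simple apply computable_ifb; computability | idtac ]
  end.

(** * A computable enumeration of the halting problem *)

(* A number [s] stands for the finite set of its binary digits, each of them  *)
(* the code of a triple (c, n, y) read as "program c on input n outputs y".   *)
Definition mem_facts (s c n y : nat) : bool :=
  odd (s %/ 2 ^ cpair c (cpair n y)).

(* The clause of [eval] for a program with code [c >= 5] whose constructor is *)
(* given by [k] and whose immediate subprograms have codes [f] and [g] (or    *)
(* [h], for [Mu]).                                                            *)
Definition justified_step (s c n y k f g h : nat) : bool :=
  if k == 0 then mem_facts s f n (cfst y) && mem_facts s g n (csnd y) else
  if k == 1 then has (fun a => mem_facts s g n a && mem_facts s f a y) (iota 0 s) else
  if k == 2 then
    if csnd n == 0 then mem_facts s f (cfst n) y else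
    has (fun i => mem_facts s c (cpair (cfst n) (csnd n).-1) i &&
                  mem_facts s g (cpair (cfst n) (cpair (csnd n).-1 i)) y) (iota 0 s)
  else
  mem_facts s h (cpair n y) 0 &&
  all (fun k => has (fun v => mem_facts s h (cpair n k) v.+1) (iota 0 s)) (iota 0 y).

Definition justified (s c n y : nat) : bool :=
  if c == 0 then y == 0 else
  if c == 1 then y == n.+1 else
  if c == 2 then y == cfst n else
  if c == 3 then y == csnd n else
  if c == 4 then y == 0 else
  justified_step s c n y ((c - 5) %% 4)
    (cfst ((c - 5) %/ 4)) (csnd ((c - 5) %/ 4)) ((c - 8) %/ 4).

(* Closed sets need no order on their facts: every clause appeals to proper  *)
(* subprograms, or to the same [PRec] with a smaller counter, so a closed set *)
(* contains only true facts.                                                  *)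
Definition closed_facts (s : nat) : bool :=
  all (fun t => odd (s %/ 2 ^ t) ==> justified s (cfst t) (cfst (csnd t)) (csnd (csnd t)))
    (iota 0 s).

Definition halts_by (e s : nat) : bool :=
  has (fun s' => closed_facts s' && has (fun y => mem_facts s' e e y) (iota 0 s'))
    (iota 0 s).

Lemma computable_halts_by O f g :
  computable_in O f -> computable_in O g ->
  computable_in O (fun n => halts_by (f n) (g n)).
Proof.
move=> Cf Cg.
apply: (@computable_ext O (fun n => halts_by (cfst (cpair (f n) (g n)))
                                             (csnd (cpair (f n) (g n))))).
  by move=> n; rewrite cfst_pair csnd_pair.
apply: (@computable_comp O (fun q => halts_by (cfst q) (csnd q))); last first.
  exact: computable_cpair.
rewrite /halts_by /closed_facts /justified /justified_step /mem_facts.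
computability.
Qed.

Lemma leq_halts_by e s s' : s <= s' -> halts_by e s -> halts_by e s'.
Proof.
move=> le_ss' /hasP[r]; rewrite mem_iota /= => lt_rs Hr; apply/hasP; exists r => //.
by rewrite mem_iota /= (leq_trans lt_rs).
Qed.

(** A set bit gives [2 ^ t <= s]. Hence every search through the facts of [s] may be bounded by [s],
    which keeps [closed_facts] decidable. *)
Lemma lt_bit t s : odd (s %/ 2 ^ t) -> t < s.
Proof.
move=> odd_st; apply: leq_trans (ltn_expl t (isT : 1 < 2)) _.
by rewrite leqNgt; apply/negP => /divn_small st0; rewrite st0 in odd_st.
Qed.

Lemma lt_mem_facts s c n y : mem_facts s c n y -> y < s.
Proof.
move=> /lt_bit; apply: leq_ltn_trans.
by apply: leq_trans (leq_cpair _ _); apply: leq_trans (leq_addl _ _);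
   apply: leq_trans (leq_cpair _ _); apply: leq_addl.
Qed.

(** One unfolding of [eval] for the empty oracle, with subcomputations looked up in [D]. It is used
    with [D] a bit set, [eval] itself, and a finite list. *)
Definition Justified (D : nat -> nat -> nat -> Prop) (p : code) (n y : nat) : Prop :=
  match p with
  | Zero => y = 0
  | Succ => y = n.+1
  | Fst => y = cfst n
  | Snd => y = csnd n
  | Oracle => y = 0
  | Pair f g => D (encode f) n (cfst y) /\ D (encode g) n (csnd y)
  | Comp f g => exists2 a, D (encode g) n a & D (encode f) a y
  | PRec f g =>
    if csnd n is k.+1 then
      exists2 i, D (encode (PRec f g)) (cpair (cfst n) k) i
               & D (encode g) (cpair (cfst n) (cpair k i)) y
    else D (encode f) (cfst n) y
  | Mu f => D (encode f) (cpair n y) 0 /\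
      forall k, k < y -> exists v, D (encode f) (cpair n k) v.+1
  end.

Lemma has_iotaP (P : pred nat) s :
  (forall a, P a -> a < s) -> reflect (exists a, P a) (has P (iota 0 s)).
Proof.
move=> Ps; apply: (iffP hasP) => [[a _ Pa]|[a Pa]]; exists a => //.
by rewrite mem_iota /= Ps.
Qed.

Lemma all_iotaP (P : pred nat) s :
  reflect (forall a, a < s -> P a) (all P (iota 0 s)).
Proof.
apply: (iffP allP) => allP a; first by move=> lt_as; apply: allP; rewrite mem_iota.
by rewrite mem_iota; apply: allP.
Qed.

Lemma justifiedP s p n y :
  justified s (encode p) n y <-> Justified (mem_facts s) p n y.
Proof.
rewrite /justified; case: p => [||||| f g | f g | f g | f] /=;
  try by split=> [/eqP|->].
- have [-> ->] : (5 + 4 * cpair (encode f) (encode g) - 5) %% 4 = 0 /\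
             (5 + 4 * cpair (encode f) (encode g) - 5) %/ 4 =
             cpair (encode f) (encode g) by lia.
  rewrite /justified_step /= cfst_pair csnd_pair.
  by split=> /andP.
- have [-> ->] : (6 + 4 * cpair (encode f) (encode g) - 5) %% 4 = 1 /\
             (6 + 4 * cpair (encode f) (encode g) - 5) %/ 4 =
             cpair (encode f) (encode g) by lia.
  rewrite /justified_step /= cfst_pair csnd_pair; split.
    by case/hasP => a _ /andP[]; exists a.
  case=> a ga fy; apply/has_iotaP; last by exists a; rewrite ga.
  by move=> b /andP[/lt_mem_facts].
- have [-> ->] : (7 + 4 * cpair (encode f) (encode g) - 5) %% 4 = 2 /\
             (7 + 4 * cpair (encode f) (encode g) - 5) %/ 4 =
             cpair (encode f) (encode g) by lia.
  rewrite /justified_step /= cfst_pair csnd_pair; case: (csnd n) => [|k] //=; split.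
    by case/hasP => a _ /andP[]; exists a.
  case=> a ga fy; apply/has_iotaP; last by exists a; apply/andP.
  by move=> b /andP[/lt_mem_facts].
- have [-> ->] : (8 + 4 * encode f - 5) %% 4 = 3 /\
             (8 + 4 * encode f - 8) %/ 4 = encode f by lia.
  have bnd k v : mem_facts s (encode f) (cpair n k) v.+1 -> v < s.
    by move/lt_mem_facts; lia.
  rewrite /justified_step /=; split.
    move=> /andP[f0 /all_iotaP fS]; split=> // k /fS /(has_iotaP (bnd k)).
    by [].
  move=> [f0 fS]; rewrite f0; apply/all_iotaP => k /fS fk.
  exact/(has_iotaP (bnd k)).
Qed.

Lemma closed_factsP s :
  closed_facts s <->
  forall p n y, mem_facts s (encode p) n y -> Justified (mem_facts s) p n y.
Proof.
split=> [/all_iotaP Hs p n y spny | Hs].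
  have := Hs _ (lt_bit spny); rewrite !(cfst_pair, csnd_pair).
  by rewrite -/(mem_facts s (encode p) n y) spny /= => /justifiedP.
apply/all_iotaP => t _; apply/implyP.
have [p ep] := encode_surj (cfst t); rewrite -ep.
have -> : t = cpair (encode p) (cpair (cfst (csnd t)) (csnd (csnd t))).
  by rewrite ep !cpair_cfst_csnd.
by rewrite !(cfst_pair, csnd_pair) => /Hs /justifiedP.
Qed.

Lemma eval_Justified p n y :
  eval set0 p n y <->
  Justified (fun c n y => exists2 q, encode q = c & eval set0 q n y) p n y.
Proof.
have sub q m z :
    (exists2 q', encode q' = encode q & eval set0 q' m z) <-> eval set0 q m z.
  by split=> [[q' /encode_inj ->]|] //; exists q.
case: p => [||||| f g | f g | f g | f] //=.
- by have -> : `[< set0 n >] = false by apply/asboolP.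
- rewrite !sub; split=> [[a [b [fa gb ->]]]|[fa gb]].
    by rewrite -/(cpair a b) cfst_pair csnd_pair.
  by exists (cfst y), (csnd y); split=> //; rewrite -[LHS]cpair_cfst_csnd.
- by split=> [[a ga fa]|[a /sub ga /sub fa]]; exists a => //; apply/sub.
- have -> : Cantor.of_nat n = (cfst n, csnd n) by rewrite -surjective_pairing.
  case: (csnd n) => [|k]; first by rewrite sub.
  split=> [[i ri gy]|[i /(sub (PRec f g)) ri /(sub g) gy]]; exists i => //.
  - by apply/(sub (PRec f g)); rewrite /= /cpair Cantor.cancel_of_to.
  - by exists g.
  - by move: ri; rewrite /= /cpair Cantor.cancel_of_to.
- rewrite sub; split=> -[f0 fS]; split=> // k /fS[v Hv]; exists v; exact/sub.
Qed.

Lemma closed_facts_sound s p n y :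
  closed_facts s -> mem_facts s (encode p) n y -> eval set0 p n y.
Proof.
move=> /closed_factsP clos.
elim: p n y => [||||| f IHf g IHg | f IHf g IHg | f IHf g IHg | f IHf] n y /clos H; apply/eval_Justified; move: H => //= H.
- by case: H => /IHf Hf /IHg Hg; split; [exists f | exists g].
- by case: H => a /IHg Hg /IHf Hf; exists a; [exists g | exists f].
- rewrite -[n]cpair_cfst_csnd csnd_pair cfst_pair; move: H.
  (* The [PRec] clause appeals to the same program, so an inner induction on the counter is
     needed. *)
  elim: (csnd n) (cfst n) y => [|k IHk] a y; first by move/IHf; exists f.
  case=> i /(clos (PRec f g)) /=; rewrite cfst_pair csnd_pair => /IHk Hk /IHg Hg.
  exists i; last by exists g.
  by exists (PRec f g) => //; apply/eval_Justified; rewrite /= cfst_pair csnd_pair.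
- case: H => /IHf H0 H; split=> [|k /H[v /IHf]]; first by exists f.
  by exists v, f.
Qed.

Lemma Justified_mono (D E : nat -> nat -> nat -> Prop) p n y :
  (forall c n y, D c n y -> E c n y) -> Justified D p n y -> Justified E p n y.
Proof.
move=> DE; case: p => [||||| f g | f g | f g | f] //=.
- by case=> /DE ? /DE.
- by case=> a /DE ? /DE ?; exists a.
- by case: (csnd n) => [|k]; [exact: DE | case=> a /DE ? /DE ?; exists a].
- by case=> /DE f0 fS; split=> // k /fS[v /DE]; exists v.
Qed.

(** * Completeness: halting computations have finite closed sets of facts *)

Definition fact : Type := (nat * nat * nat)%type.
(** The list counterpart of [closed_facts]: lists are easy to extend and concatenate, and become bit
    sets only in [halts_byP]. *)
Definition closed_seq (L : seq fact) : Prop :=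
  forall p n y, (encode p, n, y) \in L ->
    Justified (fun c n y => (c, n, y) \in L) p n y.
Definition derivable (t : fact) : Prop := exists2 L, closed_seq L & t \in L.

Lemma derivable_seq (L : seq fact) :
  (forall t, t \in L -> derivable t) -> exists2 L', closed_seq L' & {subset L <= L'}.
Proof.
elim: L => [|t L IHL] der; first by exists [::].
have [L1 cl1 sub1] : exists2 L', closed_seq L' & {subset L <= L'}.
  by apply: IHL => t' Lt'; apply: der; rewrite in_cons Lt' orbT.
have [L2 cl2 L2t] := der t (mem_head t L).
exists (L1 ++ L2) => [p n y|t'].
  rewrite mem_cat => /orP[/cl1|/cl2]; apply: Justified_mono => c m z;
  by rewrite mem_cat => ->; rewrite ?orbT.
by rewrite in_cons mem_cat => /predU1P[->|/sub1 ->]; rewrite ?L2t ?orbT.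
Qed.

Lemma derivable_step (L : seq fact) p n y :
    (forall t, t \in L -> derivable t) ->
    Justified (fun c n y => (c, n, y) \in L) p n y ->
  derivable (encode p, n, y).
Proof.
move=> /derivable_seq[L' cl sub] Jp; exists ((encode p, n, y) :: L'); last exact: mem_head.
move=> q m z; rewrite in_cons => /predU1P[[/encode_inj -> -> ->]|/cl].
  by apply: Justified_mono Jp => c k x /sub; rewrite in_cons => ->; rewrite orbT.
by apply: Justified_mono => c k x; rewrite in_cons => ->; rewrite orbT.
Qed.

Lemma eval_derivable p n y : eval set0 p n y -> derivable (encode p, n, y).
Proof.
elim: p n y => [||||| f IHf g IHg | f IHf g IHg | f IHf g IHg | f IHf] n y /eval_Justified H;
  try (by apply: (@derivable_step [::])); move: H => /= H.
- case: H => -[f' /encode_inj -> fn] [g' /encode_inj -> gn].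
  apply: (@derivable_step [:: (encode f, n, cfst y); (encode g, n, csnd y)] (Pair f g)).
    by move=> t; rewrite !inE => /orP[]/eqP->; [apply: IHf | apply: IHg].
  by rewrite /= !inE !eqxx ?orbT.
- case: H => a [g' /encode_inj -> gn] [f' /encode_inj -> fa].
  apply: (@derivable_step [:: (encode f, a, y); (encode g, n, a)] (Comp f g)).
    by move=> t; rewrite !inE => /orP[]/eqP->; [apply: IHf | apply: IHg].
  by exists a; rewrite !inE !eqxx ?orbT.
- have {H} : eval set0 (PRec f g) n y by exact/eval_Justified.
  rewrite -[n]cpair_cfst_csnd; elim: (csnd n) (cfst n) y => [|k IHk] a y;
    move=> /eval_Justified; rewrite /= csnd_pair cfst_pair.
    case=> f' /encode_inj -> fa; apply: (@derivable_step [:: (encode f, a, y)] (PRec f g)).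
      by move=> t; rewrite inE => /eqP->; apply: IHf.
    by rewrite /= csnd_pair cfst_pair !inE.
  case=> i [r /(@encode_inj _ (PRec f g)) -> ri] [g' /encode_inj -> gy].
  apply: (@derivable_step [:: (encode (PRec f g), cpair a k, i);
                              (encode g, cpair a (cpair k i), y)] (PRec f g)).
    by move=> t; rewrite !inE => /orP[]/eqP->; [apply: IHk | apply: IHg].
  by rewrite /= csnd_pair cfst_pair; exists i; rewrite !inE !eqxx ?orbT.
- case: H => -[f' /encode_inj -> f0] fS.
  (* The bound moves under the existential so that [choice] yields a total function; 0 is a default
     value. *)
  have {}fS k : exists v, k < y -> eval set0 f (cpair n k) v.+1.
    case: (ltnP k y) => [/fS[v [q /encode_inj -> fv]]|]; last by exists 0.
    by exists v.
  have [v Hv] := choice fS.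
  apply: (@derivable_step ((encode f, cpair n y, 0) ::
            [seq (encode f, cpair n k, (v k).+1) | k <- iota 0 y]) (Mu f)).
    move=> t; rewrite inE => /predU1P[->|/mapP[k]]; first exact: IHf.
    by rewrite mem_iota => /andP[_ ky] ->; apply/IHf/Hv.
  split=> [|k ky]; first exact: mem_head.
  exists (v k); rewrite inE; apply/orP; right; apply/mapP; exists k => //.
  by rewrite mem_iota.
Qed.

Lemma exists_bits (P : pred nat) N :
  exists s, forall t, odd (s %/ 2 ^ t) = (t < N) && P t.
Proof.
elim: N P => [|N IHN] P; first by exists 0 => t; rewrite div0n.
have [s Hs] := IHN (fun t => P t.+1).
exists (P 0 + s.*2) => -[|t]; first by rewrite divn1 oddD odd_double addbF oddb.
rewrite expnS divnMA divn2 ltnS -Hs; congr (odd (_ %/ _)).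
by case: (P 0); rewrite ?add0n ?add1n ?doubleK //= uphalf_double.
Qed.

Lemma halts_byP e : halting_problem e <-> exists s, halts_by e s.
Proof.
split=> [[p [<- [y /eval_derivable[L cl Lpy]]]]|[s /hasP[s' _ /andP[cl /hasP[y _ spy]]]]].
  pose num (t : fact) := cpair t.1.1 (cpair t.1.2 t.2).
  have num_inj : injective num.
    move=> [[c n] z] [[c' n'] z'] /= eq_num.
    have := congr1 cfst eq_num; have := congr1 csnd eq_num.
    rewrite /num !(cfst_pair, csnd_pair) /= => eq_num2 ->.
    have := congr1 cfst eq_num2; have := congr1 csnd eq_num2.
    by rewrite !(cfst_pair, csnd_pair) => -> ->.
  (* The bound exceeds every fact number in [L], so no fact is cut off. *)
  have [s Hs] := exists_bits (mem (map num L)) (\max_(t <- map num L) t).+1.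
  have sE c n z : mem_facts s c n z = ((c, n, z) \in L).
    rewrite -(mem_map num_inj) /mem_facts Hs /=; apply: andb_idl => Lt.
    by rewrite ltnS; apply: (leq_bigmax_seq (F := id) (P := xpredT)) Lt _.
  exists s.+1; apply/hasP; exists s; first by rewrite mem_iota /= ltnS.
  apply/andP; split.
    apply/closed_factsP => q n z; rewrite sE => /cl.
    by apply: Justified_mono => c' n' z'; rewrite sE.
  apply/has_iotaP; last by exists y; rewrite sE.
  by move=> z; apply: lt_mem_facts.
have [p ep] := encode_surj e; exists p; split=> //; exists y.
by apply: closed_facts_sound cl _; rewrite ep.
Qed.

(** * Gaps and lowest digits in base 7 *)

Local Notation lam := (logn 7).
Local Notation mu := (trunc_log 7).

(* [k] is the upper end of a gap of [w]; the lower end is mu (w %% 7 ^ k). *)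
Definition gap_at (w k : nat) : bool := (7 ^ k <= w %% 7 ^ k.+1) && (0 < w %% 7 ^ k).

Definition gaps (Q : nat -> nat -> bool) (w : nat) : nat :=
  \sum_(k < w) (gap_at w k && Q (mu (w %% 7 ^ k)) k).

(** No digit of [w] sits at a position [k >= w], as [w < 7 ^ k]. A common range lets the gaps of
    [x], [y] and [x + y] be compared termwise. *)
Lemma gaps_widen Q w B :
  w <= B -> gaps Q w = \sum_(k < B) (gap_at w k && Q (mu (w %% 7 ^ k)) k).
Proof.
move=> le_wB; rewrite /gaps.
rewrite (big_ord_widen _ (fun k => gap_at w k && Q (mu (w %% 7 ^ k)) k : nat) le_wB).
rewrite big_mkcond; apply: eq_bigr => k _; case: ltnP => // le_wk.
rewrite /gap_at modn_small; last exact: leq_ltn_trans (leqW le_wk) (ltn_expl k.+1 _).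
by rewrite leqNgt (leq_ltn_trans le_wk) // ltn_expl.
Qed.

Lemma eq_gaps Q Q' w :
  (forall n k, n <= mu w -> Q n k = Q' n k) -> gaps Q w = gaps Q' w.
Proof.
move=> eqQ; apply: eq_bigr => k _; rewrite eqQ //.
by apply: leq_trunc_log; apply: leq_mod.
Qed.

Lemma muD L x a : x < 7 ^ L -> 7 ^ L %| a -> 0 < a -> mu (x + a) = mu a.
Proof.
move=> lt_x /dvdnP[b ->] a0.
have b0 : 0 < b by case: b a0.
have lo := trunc_logP (isT : 1 < 7) a0.
have hi := trunc_log_ltn (b * 7 ^ L) (isT : 1 < 7).
apply: trunc_log_eq => //; apply/andP; split; first exact: leq_trans lo (leq_addl _ _).
set t := trunc_log _ _ in lo hi *.
have le_Lt : L <= t.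
  by apply: trunc_log_max => //; rewrite leq_pmull.
move: hi; rewrite -(subnK (leqW le_Lt)) expnD ltn_pmul2r ?expn_gt0 // => hi.
apply: leq_trans (_ : b.+1 * 7 ^ L <= _); last by rewrite leq_pmul2r ?expn_gt0.
by rewrite mulSn -addSn leq_add2r.
Qed.

(** Let [L = lam y]. Positions below [L] see only [x], positions above [L] only [y], and position
    [L] closes the new gap, whose lower end is [mu x]. *)
Lemma gapsD Q x y : 0 < x -> 0 < y -> x < 7 ^ lam y ->
  gaps Q (x + y) = gaps Q x + Q (mu x) (lam y) + gaps Q y.
Proof.
move=> x0 y0; set L := lam y => lt_x.
have dvd_y : 7 ^ L %| y by rewrite pfactor_dvdn.
have ndvd_y : ~~ (7 ^ L.+1 %| y) by rewrite pfactor_dvdn // ltnn.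
have lt_Ly : L < x + y.
  apply: leq_trans (ltn_expl L (isT : 1 < 7)) _.
  by apply: leq_trans (dvdn_leq y0 dvd_y) _; apply: leq_addl.
rewrite (gaps_widen _ (leq_addr y x)) (gaps_widen _ (leq_addl x y)) /gaps.
have -> : Q (mu x) L = \sum_(k < x + y) ((k == L :> nat) && Q (mu x) L) :> nat.
  rewrite (bigD1 (Ordinal lt_Ly)) //= eqxx /= big1 ?addn0 // => k.
  by rewrite -val_eqE /= => /negbTE ->.
rewrite -!big_split /=; apply: eq_bigr => -[k /= _] _; rewrite /gap_at.
have low j : j <= L -> (x + y) %% 7 ^ j = x %% 7 ^ j /\ y %% 7 ^ j = 0.
  move=> le_jL; have dvd_j : 7 ^ j %| y by apply: dvdn_trans dvd_y; rewrite dvdn_exp2l.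
  by split; [rewrite -(modnDmr x) (eqP dvd_j) addn0 | apply/eqP].
have high j : L <= j ->
    [/\ (x + y) %% 7 ^ j = x + y %% 7 ^ j, x %% 7 ^ j = x & 7 ^ L %| y %% 7 ^ j].
  move=> le_Lj; have lt_xj : x < 7 ^ j by apply: leq_trans lt_x _; rewrite leq_exp2l.
  have dvd_m : 7 ^ L %| y %% 7 ^ j.
    by rewrite /dvdn modn_dvdm ?dvdn_exp2l.
  split=> //; last exact: modn_small.
  rewrite -modnDmr modn_small //.
  have := ltn_pmod y (expn_gt0 7 j); case/dvdnP: dvd_m => b ->.
  rewrite -(subnK le_Lj) expnD ltn_pmul2r ?expn_gt0 // => lt_b.
  apply: leq_trans (_ : b.+1 * 7 ^ L <= _); last by rewrite leq_pmul2r ?expn_gt0.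
  by rewrite mulSn -addSn leq_add2r.
case: (ltngtP k L) => [lt_kL | lt_Lk | ->].
- have [-> ->] := low _ lt_kL; have [-> ->] := low _ (ltnW lt_kL).
  by rewrite ltnn andbF /= !addn0.
- have [-> -> dvd1] := high _ (leqW (ltnW lt_Lk)).
  have [-> -> dvd0] := high _ (ltnW lt_Lk).
  have lt_xk : x < 7 ^ k by apply: leq_trans lt_x _; rewrite leq_exp2l // ltnW.
  have y_k0 : 0 < y %% 7 ^ k.
    rewrite lt0n; apply: contra ndvd_y => dvd_yk; apply: dvdn_trans dvd_yk.
    by rewrite dvdn_exp2l.
  rewrite [7 ^ k <= x]leqNgt lt_xk /= !add0n (muD lt_x) // y_k0 addn_gt0 x0 /=.
  congr (nat_of_bool (_ && _)); congr (_ && _).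
  apply/idP/idP => [|le_k]; last exact: leq_trans le_k (leq_addl _ _).
  (* Both [y %% 7 ^ k.+1] and [7 ^ k] are multiples of [7 ^ L], so adding [x < 7 ^ L] cannot cross
     from below to above. *)
  case/dvdnP: dvd1 => b ->; rewrite -(subnK (ltnW lt_Lk)) expnD.
  rewrite leq_pmul2r ?expn_gt0 // => le_k; rewrite leqNgt; apply/negP => lt_b.
  have : b.+1 * 7 ^ L <= 7 ^ (k - L) * 7 ^ L by rewrite leq_pmul2r ?expn_gt0.
  by rewrite mulSn; move: lt_x le_k; lia.
- have [-> _ dvd1] := high _ (leqnSn L); have [-> ->] := low _ (leqnn L).
  have x_L : x %% 7 ^ L = x by exact: modn_small.
  have x_L1 : x %% 7 ^ L.+1 = x.
    by apply: modn_small; apply: leq_trans lt_x _; rewrite leq_exp2l.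
  rewrite x_L x_L1 ltnn andbF x0 andbT addn0 [7 ^ L <= x]leqNgt lt_x /= add0n.
  suff -> : 7 ^ L <= x + y %% 7 ^ L.+1 by [].
  apply: leq_trans (leq_addl _ _); apply: dvdn_leq => //.
  by rewrite lt0n.
Qed.

Definition lead (w : nat) : nat := (w %/ 7 ^ lam w) %% 7.
(* The nonzero squares mod 7 are 1, 2 and 4, which halving maps to 0, 1 and 2. *)
Definition lead_class (w : nat) : nat := (lead w ^ 2 %% 7) %/ 2.

Lemma lam_lead l u : u %% 7 != 0 -> lam (7 ^ l * u) = l /\ lead (7 ^ l * u) = u %% 7.
Proof.
move=> u7; have u0 : 0 < u by case: u u7.
have lamE : lam (7 ^ l * u) = l.
  rewrite lognM ?expn_gt0 // lognX logn_prime // eqxx muln1.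
  by rewrite (lognE 7 u) /dvdn (negbTE u7) !andbF addn0.
by split=> //; rewrite /lead lamE mulKn ?expn_gt0.
Qed.

Lemma lamP w : 0 < w -> exists2 u, w = 7 ^ lam w * u & u %% 7 = lead w /\ u %% 7 != 0.
Proof.
move=> w0; exists (w %/ 7 ^ lam w); first by rewrite mulnC divnK // pfactor_dvdn.
split=> //; rewrite -/(dvdn 7 _); apply/negP => dvd7.
have : 7 ^ (lam w).+1 %| w.
  by rewrite expnSr mulnC -dvdn_divRL // pfactor_dvdn.
by rewrite pfactor_dvdn // ltnn.
Qed.

Lemma leadD x y : 0 < x -> 0 < y -> x < 7 ^ lam y -> lead (x + y) = lead x.
Proof.
move=> x0 y0 lt_x; have [u xE [leadx u7]] := lamP x0.
have lt_lam : lam x < lam y.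
  rewrite -(ltn_exp2l _ _ (isT : 1 < 7)); apply: leq_ltn_trans lt_x.
  by apply: dvdn_leq => //; rewrite pfactor_dvdn.
have /dvdnP[v yE] : 7 ^ (lam x).+1 %| y by rewrite pfactor_dvdn.
have -> : x + y = 7 ^ lam x * (u + v * 7) by rewrite {1}xE {1}yE expnSr; lia.
have uv7 : (u + v * 7) %% 7 = u %% 7 by rewrite addnC modnMDl.
by have [|_ ->] := @lam_lead (lam x) (u + v * 7); rewrite uv7.
Qed.

(** * The coloring *)

(** Serves to compute [mu] and [lam] as numbers of indices below them. *)
Lemma sum_ltn_const t b : t <= b -> \sum_(k < b) (k < t : nat) = t.
Proof.
move=> le_tb; rewrite -[RHS](card_ord t) -sum1_card.
rewrite (big_ord_widen _ (fun=> 1) le_tb) [RHS]big_mkcond /=.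
by apply: eq_bigr => k _; case: ltnP.
Qed.

Lemma computable_mu O f : computable_in O f -> computable_in O (fun n => mu (f n)).
Proof.
move=> Cf; apply: (@computable_ext O (fun n => \sum_(k < f n) (7 ^ k.+1 <= f n))).
  move=> n; case: (posnP (f n)) => [->|f0]; first by rewrite big_ord0.
  have le_mu := trunc_logP (isT : 1 < 7) f0.
  rewrite -[RHS](@sum_ltn_const _ (f n)).
    apply: eq_bigr => k _; congr nat_of_bool; apply/idP/idP; first exact: trunc_log_max.
    by move=> lt_k; apply: leq_trans le_mu; rewrite leq_exp2l.
  by apply: leq_trans le_mu; apply/ltnW/ltn_expl.
apply: (@computable_sum O (fun n k => 7 ^ k.+1 <= f n)) => //.
have Cff : computable_in O (fun q => f (cfst q)).
  exact: computable_comp Cf (computable_cfst (computable_id O)).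
by computability.
Qed.

Lemma computable_lam O f : computable_in O f -> computable_in O (fun n => lam (f n)).
Proof.
move=> Cf; apply: (@computable_ext O (fun n => \sum_(k < f n) (f n %% 7 ^ k.+1 == 0))).
  move=> n; case: (posnP (f n)) => [->|f0]; first by rewrite big_ord0.
  rewrite -[RHS](@sum_ltn_const _ (f n)); last by apply: ltnW; apply: ltn_logl.
  by apply: eq_bigr => k _; rewrite -/(dvdn _ _) pfactor_dvdn.
apply: (@computable_sum O (fun n k => f n %% 7 ^ k.+1 == 0)) => //.
have Cff : computable_in O (fun q => f (cfst q)).
  exact: computable_comp Cf (computable_cfst (computable_id O)).
by computability.
Qed.

(** With [m = mu w] this makes a gap very short in [w]; [late_ever], the limit in [m], makes it
    short. *)
Definition late (m n k : nat) : bool :=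
  has (fun e => halts_by e m && ~~ halts_by e k) (iota 0 n.+1).

Definition gap_parity (w : nat) : bool := odd (gaps (late (mu w)) w).

Definition color (w : nat) : 'I_3 :=
  Ordinal (ltn_pmod (lead_class w + gap_parity w) (isT : 0 < 3)).

Lemma computable_color : computable (fun w => color w : nat).
Proof.
rewrite /computable.
apply: (@computable_ext _ (fun w => (lead_class w + gap_parity w) %% 3)) => //.
rewrite /lead_class /lead /gap_parity /gaps; computability.
  exact/computable_lam/computable_id.
apply: (@computable_sum _ (fun w k =>
  gap_at w k && late (mu w) (mu (w %% 7 ^ k)) k)); last exact: computable_id.
rewrite /gap_at /late; computability;
  repeat (first [apply: computable_mu | apply: computable_halts_by]; computability).
Qed.

(** * Short gaps as limits of very short gaps *)

Lemma halting_stage n :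
  exists s, forall e, e <= n -> halting_problem e -> halts_by e s.
Proof.
elim: n => [|n [s Hs]].
  have [/halts_byP[s Hs]|nH] := pselect (halting_problem 0).
    by exists s => e; rewrite leqn0 => /eqP->.
  by exists 0 => e; rewrite leqn0 => /eqP->.
have [/halts_byP[s' Hs']|nH] := pselect (halting_problem n.+1); last first.
  by exists s => e; rewrite leq_eqVlt => /predU1P[->|/Hs].
exists (maxn s s') => e; rewrite leq_eqVlt => /predU1P[-> _|lt_en He].
  exact: leq_halts_by (leq_maxr _ _) Hs'.
by apply: leq_halts_by (leq_maxl _ _) _; apply: Hs.
Qed.

Definition late_ever (n k : nat) : bool :=
  `[< exists2 e, e <= n & halting_problem e /\ ~~ halts_by e k >].

(** Take a stage by which all [e <= n] in [0'] have entered: later stages add nothing, so both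
    claims hold from there on. *)
Lemma late_stage n : exists s,
  (forall m n' k, s <= m -> n' <= n -> late m n' k = late_ever n' k) /\
  (forall m n' k, s <= k -> n' <= n -> late m n' k = false).
Proof.
have [s Hs] := halting_stage n; exists s; split=> m n' k le_s le_n.
  apply/idP/asboolP => [/hasP[e]|[e le_e [He nk]]].
    rewrite mem_iota ltnS => /andP[_ le_e] /andP[em ek]; exists e => //.
    by split=> //; apply/halts_byP; exists m.
  apply/hasP; exists e; first by rewrite mem_iota ltnS.
  by rewrite nk andbT; apply: leq_halts_by le_s _; apply: Hs => //; apply: leq_trans le_n.
apply/negP => /hasP[e]; rewrite mem_iota ltnS => /andP[_ le_e] /andP[em /negP[]].
apply: leq_halts_by le_s _; apply: Hs; first exact: leq_trans le_n.
by apply/halts_byP; exists m.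
Qed.

(* Once [y] starts late enough, the gap between [x] and [y] is not short and  *)
(* the short gaps of [x] are exactly its very short gaps inside [x + y].      *)
Lemma gap_parityD x : 0 < x -> exists s, forall y, 0 < y -> s <= lam y ->
  x < 7 ^ lam y /\ gap_parity (x + y) = odd (gaps late_ever x) (+) gap_parity y.
Proof.
move=> x0; have [s [Hs1 Hs2]] := late_stage (mu x); exists (maxn s x) => y y0.
rewrite geq_max => /andP[le_s le_x].
have lt_x : x < 7 ^ lam y by apply: leq_ltn_trans le_x (ltn_expl _ _).
split=> //; have dvd_y : 7 ^ lam y %| y by rewrite pfactor_dvdn.
rewrite /gap_parity (muD lt_x) // gapsD // Hs2 // addn0 oddD; congr (odd _ (+) _).
apply: eq_gaps => n k le_n; apply: Hs1 => //; apply: leq_trans le_s _.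
by apply: trunc_log_max => //; apply: dvdn_leq.
Qed.

Lemma FS_le_sumn n X (s : seq nat) :
  uniq s -> 0 < size s <= n -> {in s, forall x, X x} -> FS_le n X (sumn s).
Proof.
move=> uniq_s size_s sX; exists [fset x in s]%fset; split.
- by move=> x /=; rewrite in_fset => /sX.
- by rewrite card_fseq undup_id.
rewrite sumnE; apply: perm_big; apply: uniq_perm => // [|x]; first exact: fset_uniq.
by rewrite in_fset.
Qed.

Lemma lead_ltn7 w : lead w < 7.
Proof. exact: ltn_pmod. Qed.

(** With equal classes, the colors differ by the difference of two parities, which is 0 modulo 3
    only if they agree. *)
Lemma color_parity x y :
  lead_class x = lead_class y -> color x = color y -> gap_parity x = gap_parity y.
Proof.
move=> eq_d /(congr1 val) /=; rewrite eq_d; have : lead_class y < 4.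
  by rewrite /lead_class; have := ltn_pmod (lead y ^ 2) (isT : 0 < 7); lia.
by move: (lead_class y) => [|[|[|[|]]]] //; case: (gap_parity x) (gap_parity y) => [] [].
Qed.

(** The lowest digits of the three sums are [i], [2i] and [3i] modulo 7, with squares [i^2], [4i^2]
    and [2i^2], hence all three classes occur. Equal colors would then need three different
    parities. *)
Lemma no_three_same_lead x y z : 0 < x -> 0 < y -> 0 < z ->
  lam x = lam y -> lam x = lam z -> lead x = lead y -> lead x = lead z ->
  color x = color (x + y) -> color x = color (x + y + z) -> False.
Proof.
move=> x0 y0 z0 lxy lxz exy exz.
have [u xE [ux u7]] := lamP x0; have [v yE [vy _]] := lamP y0.
have [w zE [wz _]] := lamP z0.
have i0 : lead x != 0 by rewrite -ux.
have uv : (u + v) %% 7 = (2 * lead x) %% 7 by rewrite -modnDm ux vy -exy mul2n addnn.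
have uvw : (u + v + w) %% 7 = (3 * lead x) %% 7.
  by rewrite -modnDm uv wz -exz modnDml; congr (_ %% _); lia.
have xy : lead (x + y) = (2 * lead x) %% 7.
  rewrite {1}xE {1}yE -lxy -mulnDr -uv.
  have [|//] := @lam_lead (lam x) (u + v).
  by rewrite uv; have := lead_ltn7 x; lia.
have xyz : lead (x + y + z) = (3 * lead x) %% 7.
  rewrite {1}xE {1}yE {1}zE -lxy -lxz -!mulnDr -uvw.
  have [|//] := @lam_lead (lam x) (u + v + w).
  by rewrite uvw; have := lead_ltn7 x; lia.
move=> /(congr1 val) /= + /(congr1 val) /=; rewrite /lead_class xy xyz.
have := lead_ltn7 x; case: (lead x) i0 => [|[|[|[|[|[|[|]]]]]]] //= _ _;
by case: (gap_parity _) (gap_parity _) (gap_parity _) => [] [] [].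
Qed.

(** * Computing the halting problem from a monochromatic set *)

Section Solution.
Variable X : set nat.
Hypothesis X_pos : X `<=` positives.
Hypothesis X_inf : infinite_set X.
Hypothesis X_mono : monochromatic color (FS_le 3 X).

Lemma color_sumn (s t : seq nat) :
  uniq s -> uniq t -> 0 < size s <= 3 -> 0 < size t <= 3 ->
  {in s, forall x, X x} -> {in t, forall x, X x} ->
  color (sumn s) = color (sumn t).
Proof. by move=> *; apply: X_mono; apply: FS_le_sumn. Qed.

Lemma finite_same_lead l i : finite_set (X `&` [set x | lam x = l /\ lead x = i]).
Proof.
apply: contrapT => inf; set F := (_ `&` _) in inf.
have pick (s : seq nat) : exists2 x, F x & x \notin s.
  apply: contrapT => nx; apply: inf; apply: (sub_finite_set _ (finite_seq s)).
  by move=> x Fx /=; apply: contrapT => /negP xs; apply: nx; exists x.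
have [x [Xx [lx ix]] _] := pick [::].
have [y [Xy [ly iy]]] := pick [:: x]; rewrite inE => neq_yx.
have [z [Xz [lz iz]]] := pick [:: x; y]; rewrite !inE negb_or => /andP[neq_zx neq_zy].
apply: (@no_three_same_lead x y z); rewrite ?lx ?ly ?ix ?iy //; try exact: X_pos.
  have -> : x = sumn [:: x] by rewrite /= addn0.
  have -> : sumn [:: x] + y = sumn [:: x; y] by rewrite /= !addn0.
  apply: color_sumn => //; rewrite /= ?inE 1?eq_sym ?neq_yx // => t; rewrite !inE.
    by move/eqP->.
  by case/orP => /eqP->.
have -> : x = sumn [:: x] by rewrite /= addn0.
have -> : sumn [:: x] + y + z = sumn [:: x; y; z] by rewrite /= !addn0 addnA.
apply: color_sumn => //.
- by rewrite /= !inE negb_or ![x == _]eq_sym [y == z]eq_sym neq_yx neq_zx neq_zy.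
- by move=> t; rewrite !inE => /eqP->.
- by move=> t; rewrite !inE => /or3P[]/eqP->.
Qed.

Lemma exists_lead : exists i, forall L, exists x, [/\ X x, lead x = i & L <= lam x].
Proof.
apply: contrapT => no_i.
have bnd i : exists L, forall x, X x -> lead x = i -> lam x < L.
  apply: contrapT => no_L; apply: no_i; exists i => L.
  apply: contrapT => no_x; apply: no_L; exists L => x Xx xi.
  by rewrite ltnNge; apply/negP => le_L; apply: no_x; exists x.
have [L HL] := choice bnd; apply: X_inf.
apply: (@sub_finite_set _ _ (\bigcup_(i in `I_7) \bigcup_(l in `I_(L i))
   (X `&` [set x | lam x = l /\ lead x = i]))).
  move=> x Xx; exists (lead x); first exact: lead_ltn7.
  by exists (lam x); first exact: HL.
apply: bigcup_finite => [|i _]; first exact: finite_II.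
by apply: bigcup_finite => [|l _]; [exact: finite_II | exact: finite_same_lead].
Qed.

Variable i : nat.
Hypothesis iP : forall L, exists x, [/\ X x, lead x = i & L <= lam x].

(** At most two summands are allowed so that a late third one, [z], can be added. Then [sumn s + z]
    and [z] have the same color and lowest digit, hence the same gap parity, and [gap_parityD]
    cancels that of [z]. *)
Lemma even_gaps (s : seq nat) :
  uniq s -> 0 < size s <= 2 -> {in s, forall x, X x} -> 0 < sumn s ->
  lead (sumn s) = i -> ~~ odd (gaps late_ever (sumn s)).
Proof.
move=> us ss sX s0 si; have [b Hb] := gap_parityD s0.
(* Exceeding [sumn s] ensures that [z] is not already in [s]. *)
have [z [Xz zi le_z]] := iP (maxn b (sumn s)).
have z0 := X_pos Xz.
have [lt_z gp] := Hb z z0 (leq_trans (leq_maxl _ _) le_z).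
have z_notin : z \notin s.
  apply/negP => sz; have : z <= sumn s by rewrite (perm_sumn (perm_to_rem sz)) leq_addr.
  rewrite leqNgt => /negP[]; apply: leq_ltn_trans (leq_trans (leq_maxr b _) le_z) _.
  exact: ltn_logl.
suff : gap_parity (sumn s + z) = gap_parity z.
  by rewrite gp; do 2 case: odd; case: gap_parity.
apply: color_parity; first by rewrite /lead_class leadD // si zi.
have -> : sumn s + z = sumn (z :: s) by rewrite /= addnC.
have {2}-> : z = sumn [:: z] by rewrite /= addn0.
apply: color_sumn => //=; first by rewrite z_notin.
- by case/andP: ss.
- by move=> x; rewrite inE => /predU1P[->|/sX].
- by move=> x; rewrite inE => /eqP->.
Qed.

(** The short gaps of [x], of [y] and of [x + y] are all even in number, so by [gapsD] the gap from
    [mu x] to [lam y] is not short. *)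
Lemma halts_by_gap x y e : X x -> X y -> lead x = i -> lead y = i ->
  x < 7 ^ lam y -> e <= mu x -> halting_problem e -> halts_by e (lam y).
Proof.
move=> Xx Xy xi yi lt_x le_e He; have x0 := X_pos Xx; have y0 := X_pos Xy.
have neq : x != y.
  apply: contraTneq lt_x => ->; rewrite -leqNgt.
  by apply: dvdn_leq => //; rewrite pfactor_dvdn.
have ex := @even_gaps [:: x]; rewrite /= addn0 in ex.
have ey := @even_gaps [:: y]; rewrite /= addn0 in ey.
have exy := @even_gaps [:: x; y]; rewrite /= addn0 in exy.
have {ex} : ~~ odd (gaps late_ever x) by apply: ex => // t; rewrite inE => /eqP->.
have {ey} : ~~ odd (gaps late_ever y) by apply: ey => // t; rewrite inE => /eqP->.
have {exy} : ~~ odd (gaps late_ever (x + y)).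
  apply: exy => //; first by rewrite inE neq.
  - by move=> t; rewrite !inE => /orP[]/eqP->.
  - by rewrite addn_gt0 x0.
  - by rewrite leadD.
rewrite gapsD // !oddD oddb => gap_xy /negbTE odd_y /negbTE odd_x.
move: gap_xy; rewrite odd_x odd_y addbF => /asboolPn no_late.
by apply: contrapT => /negP nh; apply: no_late; exists e.
Qed.

Lemma halting_le_solution : turing_le halting_problem X.
Proof.
(* A pair [q] coding [x] and [y] to which [halts_by_gap] applies. One exists for each [e]: choose
   [x] with [lam x >= e], then [y] with [lam y >= x]. *)
pose R e q := [&& `[< X (cfst q) >], `[< X (csnd q) >], lead (cfst q) == i,
  lead (csnd q) == i, cfst q < 7 ^ lam (csnd q) & e <= mu (cfst q)].
have [||f Cf Rf] := @computable_search X R.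
- rewrite /R /lead; computability;
  repeat (first [apply: computable_mu | apply: computable_lam]; computability).
- move=> e; have [x [Xx xi le_x]] := iP e.
  have [y [Xy yi le_y]] := iP x; exists (cpair x y).
  rewrite /R cfst_pair csnd_pair xi yi !eqxx /=; apply/and4P; split; try exact/asboolP.
    exact: leq_ltn_trans le_y (ltn_expl _ _).
  apply: trunc_log_max => //; apply: leq_trans (_ : 7 ^ lam x <= _); first by rewrite leq_exp2l.
  by apply: dvdn_leq; [exact: X_pos | rewrite pfactor_dvdn //; exact: X_pos].
apply: (@computable_ext X (fun e => halts_by e (lam (csnd (f e))))); last first.
  by apply: computable_halts_by; [exact: computable_id | apply/computable_lam/computable_csnd].
move=> e; congr nat_of_bool; apply/idP/asboolP => [He|].
  by apply/halts_byP; exists (lam (csnd (f e))).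
have /and5P[/asboolP Xx /asboolP Xy /eqP xi /eqP yi /andP[lt_x le_e]] := Rf e.
exact: halts_by_gap lt_x le_e.
Qed.

End Solution.

Theorem theorem3p3 :
  exists c : nat -> 'I_3,
    computable (fun n => c n : nat) /\
    forall X : set nat,
      X `<=` positives -> infinite_set X ->
      monochromatic c (FS_le 3 X) ->
      turing_le halting_problem X.
Proof.
exists color; split=> [|X X_pos X_inf X_mono]; first exact: computable_color.
have [i iP] := exists_lead X_pos X_inf X_mono.
exact: (halting_le_solution X_pos X_mono iP).
Qed.
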